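(* Let $\mathcal{A}_1,\dots,\mathcal{A}_n$ be finite labelled transition systems, let $\mathbf{A}=\mathcal{A}_1\parallel\cdots\parallel\mathcal{A}_n$, and let $\mathcal{A}_i$ be the interface. Assume that $\mathbf{A}$ is non-divergent (with respect to the interface $\mathcal{A}_i$). Then every run of Algorithm 1 with cut-off definition 1 (for every choice of the order in which possible extensions are added) terminates with a finite branching process $\mathcal{N}$ of $\mathbf{A}$, and the folding $\mathcal{S}_i$ of the interface projection $\mathcal{N}_i$ satisfies $\mathrm{Tr}(\mathcal{S}_i)=\mathrm{Tr}(\mathbf{A})|_{\Sigma_i}$, i.e. $\mathcal{S}_i$ is a summary of $\mathbf{A}$.
   Context: A labelled transition system (LTS) is $\mathcal{A}=(\Sigma,S,T,\lambda,s^0)$ with finite action set $\Sigma$, finite state set $S$, transitions $T\subseteq S\times S$, labelling $\lambda:T\to\Sigma$, initial state $s^0$. A finite or infinite sequence $t_1t_2\dots$ of transitions is an execution if $t_k=(s_{k-1},s_k)$ for states $s_0s_1\dots$; it is a history if $s_0=s^0$. A trace is the label sequence $\lambda(t_1)\lambda(t_2)\dots$ of a (finite or infinite) history; $\mathrm{Tr}(\mathcal{A})$ is the set of traces. For LTSs $\mathcal{A}_j=(\Sigma_j,S_j,T_j,\lambda_j,s^0_j)$, $j=1..n$, the parallel composition $\mathbf{A}=\mathcal{A}_1\parallel\cdots\parallel\mathcal{A}_n$ has actions $\Sigma=\bigcup_j\Sigma_j$, global states $(s_1,\dots,s_n)\in S_1\times\cdots\times S_n$, initial state $(s^0_1,\dots,s^0_n)$,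 and global transitions $\mathbf{t}=(t_1,\dots,t_n)\ne(\star,\dots,\star)$ with label $a$ such that for each $j$: $t_j$ is an $a$-transition of $T_j$ if $a\in\Sigma_j$, and $t_j=\star$ otherwise ($\mathbf{t}$ moves each $\mathcal{A}_j$ with $t_j\ne\star$ along $t_j$ and leaves the others unchanged; $\mathcal{A}_j$ participates in $\mathbf{t}$ iff $t_j\neq\star$). The preset ${}^\bullet\mathbf{t}$ is the set of source states of the $t_j\neq\star$, the postset $\mathbf{t}^\bullet$ the set of their target states. For a set $X$ of traces, $X|_{\Sigma_i}$ is the set of projections of its elements onto $\Sigma_i$ (deleting letters not in $\Sigma_i$). $\mathbf{A}$ with interface $\mathcal{A}_i$ is divergent if some infinite trace of $\mathbf{A}$ contains only finitely many occurrences of actions of $\Sigma_i$. Branching processes of $\mathbf{A}$ are Petri nets whose places (conditions) are labelled by local states and whose transitions (events) are labelled by global transitions (hence by actions), defined inductively: (1) the net with conditions $b^0_1,\dots,b^0_n$ labelled $s^0_1,\dots,s^0_n$, no events, initial marking $\{b^0_1,\dots,b^0_n\}$ is one; (2) if some reachable marking of a branching process $\mathcal{N}$ contains a set $M$ of conditions whose labels are exactly ${}^\bullet\mathbf{t}$ for a global transition $\mathbf{t}$, and $\mathcal{N}$ has no event labelled $\mathbf{t}$ with input set $M$, then adding a new event $e$ labelled $\mathbf{t}$ with input conditions $M$ and a fresh output condition labelled $s$ for every $s\in\mathbf{t}^\bullet$ yields a branching process (such an $e$ is a possible extension). $x<y$ means there is a nonempty arc path from node $x$ to node $y$. The past of event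 $e$ is $[e]=\{e':e'\le e\}$; $M(e)$ is the marking reached by firing exactly the events of $[e]$ from the initial marking; $M(e)_j$ is its unique condition labelled by a state of $\mathcal{A}_j$; $\mathrm{St}(e)$ is the global state formed by the labels of $M(e)$. An $i$-event is an event in which $\mathcal{A}_i$ participates. Interface projection: $\mathcal{N}_i$ is the LTS whose states are the conditions labelled by states of $\mathcal{A}_i$, initial state $b^0_i$, with a transition from $b$ to $b'$ labelled $a$ for each $i$-event with action $a$, input $i$-condition $b$ and output $i$-condition $b'$. Given an equivalence $\equiv$ on its states, the folding has states the classes $[b]_\equiv$, initial state $[b^0_i]_\equiv$, and a transition $([b]_\equiv,[b']_\equiv)$ labelled $a$ for each transition $(b,b')$ labelled $a$ of $\mathcal{N}_i$. Algorithm 1: start with the branching process without events and $co=\emptyset$. While there is a possible extension $e$ none of whose causal predecessors lies in $co$, choose any such $e$ and add it to $\mathcal{N}$; by cut-off definition 1, $e$ is a cut-off (put in $co$) if it is an $i$-event and $\mathcal{N}$ already contains another $i$-event $e'$ with $\mathrm{St}(e)=\mathrm{St}(e')$ ($e'$ is its companion). On termination, $\equiv$ is the smallest equivalence relation on $i$-conditions with $M(e)_i\equiv M(e')_i$ for every cut-off $e$ with companion $e'$, and the output is the folding $\mathcal{S}_i$ of $\mathcal{N}_i$ under $\equiv$. *)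

(* Defs.v *)
From mathcomp Require Import all_boot.
From Stdlib Require Import Relations.

Set Implicit Arguments.
Unset Strict Implicit.
Unset Printing Implicit Defensive.

Inductive word (X : Type) : Type :=
| Fin of seq X
| Inf of (nat -> X).

Section Traces.
Context {Q X : Type} (q0 : Q) (step : Q -> X -> Q -> Prop).

Fixpoint ftrace (q : Q) (s : seq X) : Prop :=
  match s with
  | [::] => True
  | a :: s' => exists q', step q a q' /\ ftrace q' s'
  end.

Definition is_trace (w : word X) : Prop :=
  match w with
  | Fin s => ftrace q0 s
  | Inf u => exists qs : nat -> Q, qs 0 = q0 /\ forall k, step (qs k) (u k) (qs k.+1)
  end.
End Traces.

Definition proj {X : Type} (P : pred X) (w w' : word X) : Prop :=
  match w with
  | Fin s => w' = Fin (filter P s)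
  | Inf u =>
      (exists N, (forall k, N <= k -> ~~ P (u k)) /\
                 w' = Fin [seq u k | k <- iota 0 N & P (u k)])
   \/ (exists phi : nat -> nat,
          (forall m, phi m < phi m.+1) /\
          (forall k, P (u k) <-> exists m, phi m = k) /\
          w' = Inf (fun m => u (phi m)))
  end.

(* T is a subset of S x S, with labelling lab : T -> Sigma (lab is given on
   all pairs; only its values on tr matter). *)
Record lts (Act : finType) := LTS {
  st   : finType;
  tr   : {set st * st};
  lab  : st * st -> Act;
  s0   : st }.
Arguments lab {Act} l _.

Section Product.
Context (n : nat) (Act : finType) (Sig : 'I_n -> {set Act})
        (A : 'I_n -> lts Act).

(* a candidate global transition: a label and, per component, either
   a local transition (Some) or star (None) *)
Record gtr := GTr {
  ga    : Act;
  gcomp : forall j : 'I_n, option (st (A j) * st (A j)) }.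

Definition is_gtr (t : gtr) : Prop :=
  (exists j, ga t \in Sig j) /\
  forall j, match gcomp t j with
            | Some p => ga t \in Sig j /\ p \in tr (A j) /\ lab (A j) p = ga t
            | None => ga t \notin Sig j
            end.

Definition participates (t : gtr) (j : 'I_n) : bool := isSome (gcomp t j).

Definition gstate := forall j : 'I_n, st (A j).
Definition g0 : gstate := fun j => s0 (A j).

Definition gstep (g : gstate) (a : Act) (g' : gstate) : Prop :=
  exists t, is_gtr t /\ ga t = a /\
    forall j, match gcomp t j with
              | Some p => g j = p.1 /\ g' j = p.2
              | None => g' j = g j
              end.

Definition trA (w : word Act) : Prop := is_trace g0 gstep w.

Definition divergent (i : 'I_n) : Prop :=
  exists u : nat -> Act, trA (Inf u) /\
    exists N, forall k, N <= k -> u k \notin Sig i.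

(* Conditions: (None, j) is the initial condition b^0_j; (Some k, j) is the
   output condition of the k-th event (in order of addition) labelled by the
   target state of its j-th component. *)
Definition cond := (option nat * 'I_n)%type.

(* an event: its label (a global transition) and its input conditions,
   one for each participating component j (values at non-participating
   components are irrelevant) *)
Record event := Ev { egt : gtr; epre : 'I_n -> cond }.

(* a branching process is given by its list of events, in order of
   addition; its conditions are the initial ones plus the outputs *)
Definition bp := seq event.

Definition clab (N : bp) (j : 'I_n) (c : cond) : option (st (A j)) :=
  match c with
  | (None, j') => if j' == j then Some (s0 (A j)) else None
  | (Some k, j') =>
      if j' == j then
        match onth N k with
        | Some e => omap snd (gcomp (egt e) j)
        | None => None
        end
      else None
  end.

(* markings (every reachable marking contains exactly one condition of
   each component; we represent it as the function j |-> that condition) *)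
Definition marking := 'I_n -> cond.
Definition m0 : marking := fun j => (None, j).

Definition enabled (m : marking) (e : event) : Prop :=
  forall j p, gcomp (egt e) j = Some p -> m j = epre e j.

Definition fire (k : nat) (e : event) (m : marking) : marking :=
  fun j => if participates (egt e) j then (Some k, j) else m j.

Inductive reach (N : bp) : marking -> Prop :=
| reach0 : reach N m0
| reachS m k e : reach N m -> onth N k = Some e -> enabled m e ->
                 reach N (fire k e m).

Fixpoint fires (N : bp) (m : marking) (es : seq nat) (m' : marking) : Prop :=
  match es with
  | [::] => m' = m
  | k :: es' => exists e, onth N k = Some e /\ enabled m e /\
                          fires N (fire k e m) es' m'
  end.

Definition dprec (N : bp) (k1 k2 : nat) : Prop :=
  exists e2, onth N k2 = Some e2 /\
    exists j j', participates (egt e2) j /\ epre e2 j = (Some k1, j').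

Definition le_ev (N : bp) : relation nat := clos_refl_trans nat (dprec N).

Definition cpred (N : bp) (k : nat) (e : event) : Prop :=
  exists j k' j', participates (egt e) j /\ epre e j = (Some k', j') /\
                  le_ev N k k'.

Definition poss_ext (N : bp) (e : event) : Prop :=
  is_gtr (egt e) /\
  (exists m, reach N m /\
     forall j p, gcomp (egt e) j = Some p ->
       m j = epre e j /\ clab N j (epre e j) = Some p.1) /\
  (forall k e', onth N k = Some e' -> egt e' = egt e ->
     exists j, participates (egt e) j /\ epre e' j <> epre e j).

Definition mark_of (N : bp) (k : nat) (m : marking) : Prop :=
  exists es : seq nat, uniq es /\ (forall k', k' \in es <-> le_ev N k' k) /\
    fires N m0 es m.

Definition same_st (N : bp) (m m' : marking) : Prop :=
  forall j, clab N j (m j) = clab N j (m' j).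

Section Algo.
Context (i : 'I_n).

Definition ievent (N : bp) (k : nat) : Prop :=
  exists e, onth N k = Some e /\ participates (egt e) i.

Definition companion (N : bp) (k k' : nat) : Prop :=
  k' < k /\ ievent N k /\ ievent N k' /\
  exists m m', mark_of N k m /\ mark_of N k' m' /\ same_st N m m'.

(* one iteration of Algorithm 1: the added event, and None if it is not
   a cut-off, or Some k' if it is a cut-off with (chosen) companion k' *)
Record astep := AStep { s_ev : event; s_comp : option nat }.

Definition events (ss : seq astep) : bp := map s_ev ss.

Definition not_blocked (ss : seq astep) (e : event) : Prop :=
  forall k s, onth ss k = Some s -> cpred (events ss) k e -> s_comp s = None.

Definition step_ok (ss : seq astep) (s : astep) : Prop :=
  let N := events ss in
  let N' := rcons N (s_ev s) in
  poss_ext N (s_ev s) /\ not_blocked ss (s_ev s) /\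
  match s_comp s with
  | Some k' => companion N' (size N) k'
  | None => ~ exists k', companion N' (size N) k'
  end.

Definition valid_run (ss : seq astep) : Prop :=
  forall k s, onth ss k = Some s -> step_ok (take k ss) s.

Definition terminated (ss : seq astep) : Prop :=
  valid_run ss /\ ~ exists e, poss_ext (events ss) e /\ not_blocked ss e.

Definition ntr (N : bp) (b : cond) (a : Act) (b' : cond) : Prop :=
  exists k e p, onth N k = Some e /\ gcomp (egt e) i = Some p /\
    ga (egt e) = a /\ b = epre e i /\ b' = (Some k, i).

Definition gen_eq (ss : seq astep) (b b' : cond) : Prop :=
  exists k s k', onth ss k = Some s /\ s_comp s = Some k' /\
    exists m m', mark_of (events ss) k m /\ mark_of (events ss) k' m' /\
                 b = m i /\ b' = m' i.

Definition equiv_c (ss : seq astep) : relation cond :=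
  clos_refl_sym_trans cond (gen_eq ss).

Definition cls (ss : seq astep) (b : cond) : cond -> Prop := equiv_c ss b.

Definition fold_step (ss : seq astep) (C : cond -> Prop) (a : Act)
    (C' : cond -> Prop) : Prop :=
  exists b b', ntr (events ss) b a b' /\ C = cls ss b /\ C' = cls ss b'.

Definition trS (ss : seq astep) (w : word Act) : Prop :=
  is_trace (cls ss (None, i)) (fold_step ss) w.

End Algo.
End Product.

(* Main.v *)
(** Along any firing sequence the events of one component form a causal chain,
    so events outside a causally closed set can be postponed. Soundness: if b is
    the output i-condition of e, every condition equivalent to b carries the
    global state St(e), and an i-event e' consuming b yields an execution from
    St(e) to St(e') whose only interface action is that of e'. Completeness: a
    history is replayed in the net up to its next i-event e; the events
    concurrent with e are postponed after [e], and the replay restarts from the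
    non-cut-off event reached by following companions from e, which has the same
    global state; infinite traces follow by Koenig's lemma. Termination: the
    i-events strictly below an event have distinct global states, so
    non-divergence bounds the size of every [e], and since an event is determined
    by its label and inputs, only finitely many have a past of bounded depth. *)

From mathcomp Require Import all_boot.
From mathcomp Require Import boolp zify.
From Stdlib Require Import Relations.
Require Import Defs.

Set Implicit Arguments.
Unset Strict Implicit.
Unset Printing Implicit Defensive.

(** * Prefixes of sequences, pigeonhole and choice principles *)

Lemma onth_take_some T (s : seq T) m k x :
  onth (take m s) k = Some x <-> k < m /\ onth s k = Some x.
Proof.
elim: s m k => [|y s IHs] [|m] [|k] //=; try by split=> // -[].
by rewrite IHs.
Qed.

Lemma onth_some_lt T (s : seq T) k x : onth s k = Some x -> k < size s.
Proof. by rewrite -onthTE => ->. Qed.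

Lemma onth_of_lt T (s : seq T) k : k < size s -> exists x, onth s k = Some x.
Proof. by rewrite -onthTE; case: onth => // x _; exists x. Qed.

Lemma take_onth_rcons T (s : seq T) k x :
  onth s k = Some x -> take k.+1 s = rcons (take k s) x.
Proof.
by elim: s k => [|y s IHs] [|k] //= => [[->]|/IHs ->] //; rewrite take0.
Qed.

Lemma finite_bound (T : finType) (P : T -> nat -> Prop) :
  (forall t, exists L, P t L) -> (forall t L L', L <= L' -> P t L -> P t L') ->
  exists L, forall t, P t L.
Proof.
move=> /fin_all_exists[f Pf] mono; exists (\max_t f t) => t.
by apply: mono (Pf t); apply: leq_bigmax.
Qed.

(** Pigeonhole step of Koenig's lemma: if every [t] failed at some level, the maximum of these
    finitely many levels would be satisfied by no [t]. *)
Lemma finite_compactness (T : finType) (Q : T -> nat -> Prop) :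
  (forall t m m', m <= m' -> Q t m' -> Q t m) ->
  (forall m, exists t, Q t m) -> exists t, forall m, Q t m.
Proof.
move=> mono QP; apply: contrapT => nQ.
have [|t L L' le nq q|L nP] := @finite_bound T (fun t L => ~ Q t L).
- move=> t; apply: contrapT => nt; apply: nQ; exists t => m.
  by apply: contrapT => ?; apply: nt; exists m.
- exact: nq (mono _ _ _ le q).
- by have [t /nP] := QP L.
Qed.

(** Functional choice is applied on the subtype of points satisfying [Inv], where the relation is
    total, and the chosen function is iterated. *)
Lemma dependent_choice_inv (X : Type) (Inv : X -> Prop) (R : X -> X -> Prop) x0 :
  Inv x0 -> (forall x, Inv x -> exists y, R x y /\ Inv y) ->
  exists f, f 0 = x0 /\ forall k, R (f k) (f k.+1).
Proof.
move=> Ix0 step.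
have [|f fP] := @choice {x | Inv x} {x | Inv x} (fun x y => R (sval x) (sval y)).
  by move=> [x Ix]; have [y [Rxy Iy]] := step x Ix; exists (exist _ y Iy).
exists (fun k => sval (iter k f (exist _ x0 Ix0))); split=> // k.
Qed.

(** * Firing sequences, causality and commutation in branching processes *)

Section Nets.
Variables (n : nat) (Act : finType) (Sig : 'I_n -> {set Act}).
Variables (A : 'I_n -> lts Act) (i : 'I_n).
Implicit Types (N : bp A) (m : marking n) (g : gstate A) (e : event A).

Definition branching N :=
  forall k e, onth N k = Some e -> poss_ext Sig (take k N) e.

Lemma branching_take N k : branching N -> branching (take k N).
Proof.
move=> bN x e /onth_take_some[lt_xk Nx].
by rewrite take_takel ?(ltnW lt_xk) //; apply: bN.
Qed.

Lemma gcomp_participates (t : gtr A) j p : gcomp t j = Some p -> participates t j.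
Proof. by rewrite /participates => ->. Qed.

Lemma participates_gcomp (t : gtr A) j :
  participates t j -> exists p, gcomp t j = Some p.
Proof. by rewrite /participates; case: gcomp => // p; exists p. Qed.

Lemma participatesE (t : gtr A) j : is_gtr Sig t -> participates t j = (ga t \in Sig j).
Proof.
case=> _ /(_ j); rewrite /participates; case: gcomp => [p [-> _] //|/=].
by move/negbTE->.
Qed.

Lemma branching_gtr N k e : branching N -> onth N k = Some e -> is_gtr Sig (egt e).
Proof. by move=> bN /bN[]. Qed.

Lemma branching_participates N k e : branching N -> onth N k = Some e ->
  exists j, participates (egt e) j.
Proof.
move=> bN /(branching_gtr bN) gt; have [[j ja] _] := gt.
by exists j; rewrite participatesE.
Qed.

Lemma fire_participates k e m j : participates (egt e) j -> fire k e m j = (Some k, j).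
Proof. by rewrite /fire => ->. Qed.

Lemma fire_idle k e m j : ~~ participates (egt e) j -> fire k e m j = m j.
Proof. by rewrite /fire => /negbTE->. Qed.

Lemma fires_cat N m es es' m' :
  fires N m (es ++ es') m' <-> exists m1, fires N m es m1 /\ fires N m1 es' m'.
Proof.
elim: es m => [|k es IHes] m /=.
  by split=> [?|[m1 [-> //]]]; exists m.
split=> [[e [Nk [en /IHes[m1 [? ?]]]]]|[m1 [[e [Nk [en ?]]] ?]]].
  by exists m1; split=> //; exists e.
by exists e; do 2!split=> //; apply/IHes; exists m1.
Qed.

Lemma fires_rcons N m es k m' :
  fires N m (rcons es k) m' <->
  exists m1 e, [/\ fires N m es m1, onth N k = Some e, enabled m1 e & m' = fire k e m1].
Proof.
rewrite -cats1 fires_cat; split=> [[m1 [? /= [e [? [? ->]]]]]|[m1 [e [? ? ? ->]]]].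
  by exists m1, e.
by exists m1; split=> //=; exists e.
Qed.

Lemma fires_last N m es k e m1 : fires N m es m1 -> onth N k = Some e ->
  enabled m1 e -> fires N m (rcons es k) (fire k e m1).
Proof. by move=> ? ? ?; apply/fires_rcons; exists m1, e. Qed.

Lemma fires_take N k m es m' : fires (take k N) m es m' -> fires N m es m'.
Proof.
elim: es m => //= x es IHes m [e [/onth_take_some[_ Nx] [en /IHes fs]]].
by exists e.
Qed.

Lemma reach_fires N m : reach N m <-> exists es, fires N (m0 (n:=n)) es m.
Proof.
split=> [|[es]].
  elim=> [|m1 k e _ [es fs] Nk en]; first by exists [::].
  by exists (rcons es k); apply: fires_last.
elim/last_ind: es m => [m ->|es k IHes m]; first exact: reach0.
by move/fires_rcons=> [m1 [e [/IHes rm Nk en ->]]]; apply: reachS.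
Qed.

Lemma fires_idle N m es m' j : fires N m es m' ->
  (forall y, y \in es -> ~ ievent j N y) -> m' j = m j.
Proof.
elim: es m => [m ->//|k es IHes m /= [e [Nk [en fs]]] idle].
rewrite (IHes _ fs) => [|y yes]; last by apply: idle; rewrite inE yes orbT.
rewrite fire_idle //; apply/negP => pj.
by apply: (idle k); [rewrite mem_head | exists e].
Qed.

(* The events of a fixed component met along a firing sequence form a causal
   chain, so the current condition of that component is produced by its top. *)
Lemma fires_component N es m j : fires N (m0 (n:=n)) es m ->
  (m j = (None, j) /\ forall y, y \in es -> ~ ievent j N y) \/
  (exists z, [/\ m j = (Some z, j), z \in es, ievent j N z &
     forall y, y \in es -> ievent j N y -> le_ev N y z]).
Proof.
elim/last_ind: es m => [m ->|es k IHes m]; first by left.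
move/fires_rcons=> [m1 [e [fs Nk en ->]]].
have [pj|npj] := boolP (participates (egt e) j).
  right; exists k; split; first exact: fire_participates.
  - by rewrite mem_rcons mem_head.
  - by exists e.
  move=> y; rewrite mem_rcons inE => /predU1P[-> _|yes jy]; first exact: rt_refl.
  have [p /en mj] := participates_gcomp pj.
  case: (IHes _ fs) => [[_ /(_ y yes)//]|[z [mz _ _ /(_ y yes jy) le_yz]]].
  apply: rt_trans le_yz (rt_step _ _ _ _ _).
  by exists e; split=> //; exists j, j; split=> //; rewrite -mj.
rewrite fire_idle //.
have nk : ~ ievent j N k by case=> e'; rewrite Nk => [[[<-]]]; rewrite (negbTE npj).
case: (IHes _ fs) => [[mj nj]|[z [mz zes jz top]]]; [left|right].
  by split=> // y; rewrite mem_rcons inE => /predU1P[->|/nj].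
exists z; split=> //; first by rewrite mem_rcons inE zes orbT.
by move=> y; rewrite mem_rcons inE => /predU1P[->//|]; apply: top.
Qed.

Lemma fires_marked N es m j : fires N (m0 (n:=n)) es m ->
  m j = (None, j) \/ exists z, [/\ m j = (Some z, j), z \in es & ievent j N z].
Proof.
move=> /fires_component-/(_ j)[[]|[z [? ? ? _]]]; first by left.
by right; exists z.
Qed.

Lemma branching_epre N k e j : branching N -> onth N k = Some e ->
  participates (egt e) j -> epre e j = (None, j) \/
  exists z, [/\ epre e j = (Some z, j), z < k, ievent j N z & dprec N z k].
Proof.
move=> bN Nk pj; have [p cj] := participates_gcomp pj.
have [_ [[m [/reach_fires[es fs] /(_ _ _ cj)[mj _]]] _]] := bN _ _ Nk.
case: (fires_marked j fs) => [|[z [mz _ [e' [/onth_take_some[ltzk Nz] pz]]]]].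
  by left; rewrite -mj.
have ez : epre e j = (Some z, j) by rewrite -mj.
right; exists z; split=> //; first by exists e'.
by exists e; split=> //; exists j, j.
Qed.

Lemma dprec_lt N k k' : branching N -> dprec N k' k -> k' < k.
Proof.
move=> bN [e [Nk [j [j' [pj ej]]]]].
by case: (branching_epre bN Nk pj) => [|[z [+ ltz _ _]]]; rewrite ej // => -[->].
Qed.

Lemma le_ev_leq N k k' : branching N -> le_ev N k' k -> k' <= k.
Proof.
move=> bN; elim=> [x y /(dprec_lt bN)/ltnW //|//|x y z _ lexy _].
exact: leq_trans.
Qed.

Lemma le_ev_anti N k k' : branching N -> le_ev N k' k -> le_ev N k k' -> k = k'.
Proof. by move=> bN /(le_ev_leq bN) ? /(le_ev_leq bN) ?; lia. Qed.

Lemma le_ev_cases N k k' : le_ev N k' k ->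
  k' = k \/ exists z, dprec N z k /\ le_ev N k' z.
Proof.
move=> le; case: (clos_rt_rtn1 _ _ _ _ le) => [|z w dzw lez]; first by left.
by right; exists z; split=> //; apply: clos_rtn1_rt.
Qed.

Lemma dprec_take N l x y : y < l -> dprec (take l N) x y <-> dprec N x y.
Proof.
move=> ltyl; split=> -[e [Ny H]]; exists e; split=> //.
  by move/onth_take_some: Ny => [].
exact/onth_take_some.
Qed.

(** Causes have smaller indices than their effects, so the whole past of [y] already lies in any
    prefix containing [y]. *)
Lemma le_ev_take N l x y : branching N -> y < l ->
  le_ev (take l N) x y <-> le_ev N x y.
Proof.
move=> bN ltyl; split.
  elim=> [? ? [e [/onth_take_some[_ Ny] H]]|?|? ? ? _ ? _]; last exact: rt_trans.
  - by apply: rt_step; exists e.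
  - exact: rt_refl.
move=> le; elim: (clos_rt_rtn1 _ _ _ _ le) ltyl => [_|z w dzw _ IH ltwl]; first exact: rt_refl.
apply: rt_trans (IH _) (rt_step _ _ _ _ _); first exact: ltn_trans (dprec_lt bN dzw) _.
exact/dprec_take.
Qed.

(** When an event fires, each of its input conditions is marked, and a marked condition that is not
    initial was produced by an event fired before. *)
Lemma fires_closed N es m x y : fires N (m0 (n:=n)) es m ->
  x \in es -> le_ev N y x -> y \in es.
Proof.
move=> fs xes le; move: (clos_rt_rt1n _ _ _ _ le) => {}le; elim: le xes => //.
move=> {x y} z1 z2 z3 d12 _ IH /IH {IH}.
elim/last_ind: es m fs => // es k IHes m /fires_rcons[m1 [e [fs Nk en _]]].
rewrite !mem_rcons !inE => /predU1P[ez|z2es]; last by rewrite (IHes _ fs) ?orbT.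
move: d12 => [e2 []]; rewrite ez Nk => -[<-] [j [j' [pj ej]]].
have [p /en mj] := participates_gcomp pj; rewrite ej in mj.
case: (fires_marked j fs) => [|[w [+ wes _]]]; rewrite mj // => -[->].
by rewrite wes orbT.
Qed.

(** If [k] fired a second time, the producer [z] of one of its inputs would lie causally above the
    first occurrence of [k], so [k <= z]; but [z] is also a direct cause of [k], so [z < k]. *)
Lemma fires_uniq N es m : branching N -> fires N (m0 (n:=n)) es m -> uniq es.
Proof.
move=> bN; elim/last_ind: es m => // es k IHes m /fires_rcons[m1 [e [fs Nk en _]]].
rewrite rcons_uniq (IHes _ fs) andbT; apply/negP => kes.
have [j pj] := branching_participates bN Nk.
have [p /en mj] := participates_gcomp pj.
have jk : ievent j N k by exists e.
case: (fires_component j fs) => [[_ /(_ k kes)//]|[z [mz _ _ /(_ k kes jk)]]].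
move/(le_ev_leq bN) => lekz; have /(dprec_lt bN) : dprec N z k; last by lia.
by exists e; split=> //; exists j, j; rewrite -mj.
Qed.

(** The current condition of a component is the output of the causally largest fired event of that
    component, which depends only on the set of fired events. *)
Lemma fires_marking_unique N es es' m m' : branching N -> es =i es' ->
  fires N (m0 (n:=n)) es m -> fires N (m0 (n:=n)) es' m' -> m = m'.
Proof.
move=> bN eqes fs fs'; apply/funext => j.
case: (fires_component j fs) => [[-> nj]|[z [-> zes jz top]]].
  case: (fires_component j fs') => [[-> //]|[z [_ zes jz _]]].
  by case: (nj z); rewrite ?eqes.
case: (fires_component j fs') => [[_ /(_ z)]|[z' [-> zes' jz' top']]].
  by rewrite -eqes => /(_ zes).
by congr (Some _, _); apply: (le_ev_anti bN); [apply: top|apply: top'];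
   rewrite ?eqes // -eqes.
Qed.

(** Events sharing no component with [e] neither consume nor replace a condition that [e]
    touches. *)
Lemma fires_commute N k e m es m' :
  (forall j y, participates (egt e) j -> y \in es -> ~ ievent j N y) ->
  fires N m es m' -> fires N (fire k e m) es (fire k e m').
Proof.
elim: es m => [|x es IHes] m dis /=; first by move->.
move=> [e' [Nx [en fs]]]; exists e'; split=> //.
have disx j : participates (egt e) j -> ~~ participates (egt e') j.
  move=> pj; apply/negP => pj'; case: (dis j x pj); first exact: mem_head.
  by exists e'.
split=> [j p cj|].
  rewrite fire_idle ?(en _ _ cj) //; apply/negP => /disx.
  by rewrite (gcomp_participates cj).
have -> : fire x e' (fire k e m) = fire k e (fire x e' m).
  apply/funext => j; rewrite /fire; case: ifPn => [pj'|//].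
  by case: ifPn => // /disx; rewrite pj'.
by apply: IHes => // j y pj yes; apply: dis pj _; rewrite inE yes orbT.
Qed.

(* Events outside a causally closed set D commute past the later events of D. *)
Lemma fires_split N (D : pred nat) es m :
  (forall x y, dprec N x y -> D y -> D x) -> fires N (m0 (n:=n)) es m ->
  exists m', fires N (m0 (n:=n)) (filter D es) m' /\ fires N m' (filter (predC D) es) m.
Proof.
move=> clD; have clD' x y : le_ev N x y -> D y -> D x.
  by elim=> [a b /clD|//|a b c _ ab _ bc /bc/ab].
elim/last_ind: es m => [m ->|es k IHes m]; first by exists (m0 (n:=n)).
move/fires_rcons=> [m1 [e [fs Nk en ->]]]; have [m' [fsD fsE]] := IHes _ fs.
rewrite !filter_rcons /=; case: ifPn => [Dk|nDk] /=; last first.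
  by exists m'; split=> //; apply: fires_last en.
have dis j y : participates (egt e) j -> y \in filter (predC D) es -> ~ ievent j N y.
  move=> pj; rewrite mem_filter => /andP[/= nDy yes] jy.
  have [p /en mj] := participates_gcomp pj.
  case: (fires_component j fs) => [[_ /(_ y yes)//]|[z [mz _ _ /(_ y yes jy) le_yz]]].
  case/negP: nDy; apply: (clD' _ _ le_yz); apply: clD Dk.
  by exists e; split=> //; exists j, j; rewrite -mj.
exists (fire k e m'); split; last exact: fires_commute.
apply: fires_last => // j p cj; rewrite -(en _ _ cj); apply/esym.
by apply: fires_idle fsE _ => y; apply: dis; apply: gcomp_participates cj.
Qed.

(** The past is made Boolean by classical decision so that firing sequences can be filtered by
    it. *)
Definition past N k : pred nat := fun y => `[< le_ev N y k >].

Lemma past_closed N k x y : dprec N x y -> past N k y -> past N k x.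
Proof. by move=> d /asboolP le; apply/asboolP; apply: rt_trans le; apply: rt_step. Qed.

(** This is [fires_split] for the causally closed set of causes of [k]: its part of [es] reaches the
    marking of [k], and the rest of [es] fires afterwards. *)
Lemma past_mark N k es m : branching N -> fires N (m0 (n:=n)) es m -> k \in es ->
  exists m', mark_of N k m' /\ fires N m' (filter (predC (past N k)) es) m.
Proof.
move=> bN fs kes; have [m' [fsD fsE]] := fires_split (@past_closed N k) fs.
exists m'; split=> //; exists (filter (past N k) es); split; last split=> //.
  exact: fires_uniq fsD.
move=> y; rewrite mem_filter; split=> [/andP[/asboolP //]|le].
by apply/andP; split; [apply/asboolP | apply: fires_closed fs kes le].
Qed.

(** The reachable marking that made [e] a possible extension comes with a firing sequence; [k] is
    appended to it and the result is restricted to the past of [k], where [k] stays last. *)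
Lemma local_configuration N k e : branching N -> onth N k = Some e ->
  exists es m, [/\ fires N (m0 (n:=n)) es m, enabled m e, mark_of N k (fire k e m) &
    forall y, y \in es <-> le_ev N y k /\ y <> k].
Proof.
move=> bN Nk; have [_ [[m [/reach_fires[es fs] ej]] _]] := bN _ _ Nk.
have en : enabled m e by move=> j p /ej[].
have fsk : fires N (m0 (n:=n)) (rcons es k) (fire k e m).
  by apply: fires_last => //; apply: fires_take fs.
have [m' [fsD _]] := fires_split (@past_closed N k) fsk.
have pk : past N k k by apply/asboolP/rt_refl.
have := fsD; rewrite filter_rcons pk => fsD'.
have uq := fires_uniq bN fsD'.
have inD y : y \in rcons (filter (past N k) es) k <-> le_ev N y k.
  split=> [|le]; last by apply: fires_closed fsD' _ le; rewrite mem_rcons mem_head.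
  rewrite mem_rcons inE mem_filter => /predU1P[->|/andP[/asboolP //]].
  exact: rt_refl.
move/fires_rcons: (fsD') => [m1 [e' [fs1]]]; rewrite Nk => -[<-] en1 em'.
exists (filter (past N k) es), m1; split=> //.
  by exists (rcons (filter (past N k) es) k); rewrite -em'.
move=> y; split=> [yes|[/inD]]; last by rewrite mem_rcons inE => /predU1P[].
split; first by apply/inD; rewrite mem_rcons inE yes orbT.
by move=> eyk; move: uq; rewrite rcons_uniq -{1}eyk yes.
Qed.

Lemma mark_of_unique N k m m' : branching N -> mark_of N k m -> mark_of N k m' -> m = m'.
Proof.
move=> bN [es [_ [ines fs]]] [es' [_ [ines' fs']]].
apply: fires_marking_unique fs fs' => // y.
by apply/idP/idP => [/ines/ines'|/ines'/ines].
Qed.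

Lemma mark_of_component N k j m : branching N -> ievent j N k -> mark_of N k m ->
  m j = (Some k, j).
Proof.
move=> bN [e [Nk pj]] mk; have [es [m1 [_ _ mk1 _]]] := local_configuration bN Nk.
by rewrite (mark_of_unique bN mk mk1) fire_participates.
Qed.

Lemma mark_of_take N l k m : branching N -> k < l -> mark_of (take l N) k m ->
  mark_of N k m.
Proof.
move=> bN ltkl [es [uq [ines /fires_take fs]]]; exists es; split=> //; split=> // y.
by rewrite ines; apply: le_ev_take.
Qed.

(** * Global states of markings, and executions read off firing sequences *)

Definition labelled N m g := forall j, clab N j (m j) = Some (g j).

Lemma labelled_unique N m g g' : labelled N m g -> labelled N m g' -> g = g'.
Proof.
move=> lg lg'; apply: functional_extensionality_dep => j.
by have := lg j; rewrite lg' => -[].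
Qed.

Lemma clab_take N l j c x : clab (take l N) j c = Some x -> clab N j c = Some x.
Proof.
case: c => [[k|] j'] //=; case: eqP => // _.
by case E: (onth _ _) => [e|//]; move/onth_take_some: E => [_ ->].
Qed.

Lemma labelled_take N l m g : labelled (take l N) m g -> labelled N m g.
Proof. by move=> lg j; apply: clab_take (lg j). Qed.

Lemma labelled0 N : labelled N (m0 (n:=n)) (g0 A).
Proof. by move=> j; rewrite /= eqxx. Qed.

Fixpoint gexec g (s : seq Act) g' : Prop :=
  match s with
  | [::] => g' = g
  | a :: s' => exists g1, gstep Sig g a g1 /\ gexec g1 s' g'
  end.

Lemma gexec_cat g s s' g' :
  gexec g (s ++ s') g' <-> exists g1, gexec g s g1 /\ gexec g1 s' g'.
Proof.
elim: s g => [|a s IHs] g /=; first by split=> [?|[? [-> //]]]; exists g.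
split=> [[g1 [? /IHs[g2 [? ?]]]]|[g2 [[g1 [? ?]] ?]]].
  by exists g2; split=> //; exists g1.
by exists g1; split=> //; apply/IHs; exists g2.
Qed.

Lemma ftrace_gexec g s : ftrace (@gstep n Act Sig A) g s <-> exists g', gexec g s g'.
Proof.
elim: s g => [|a s IHs] g /=; first by split=> // _; exists g.
split=> [[g1 [? /IHs[g' ?]]]|[g' [g1 [? ?]]]]; first by exists g', g1.
by exists g1; split=> //; apply/IHs; exists g'.
Qed.

Definition comp_event j N (k : nat) : bool :=
  if onth N k is Some e then participates (egt e) j else false.

Lemma comp_eventP j N k : reflect (ievent j N k) (comp_event j N k).
Proof.
rewrite /comp_event /ievent; case: onth => [e|]; last by right=> -[e []].
by apply: (iffP idP) => [|[e' [[<-]]]] //; exists e.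
Qed.

Lemma fire_step N k e m g : branching N -> onth N k = Some e -> enabled m e ->
  labelled N m g ->
  exists g', gstep Sig g (ga (egt e)) g' /\ labelled N (fire k e m) g'.
Proof.
move=> bN Nk en lg; have [gt [[m1 [_ pre]] _]] := bN _ _ Nk.
exists (fun j => if gcomp (egt e) j is Some p then p.2 else g j); split.
  exists (egt e); do 2!split=> //; move=> j; case E: (gcomp _ _) => [p|//].
  split=> //; have [_ /clab_take] := pre _ _ E; rewrite -(en _ _ E) lg.
  by case.
move=> j; rewrite /fire /participates; case E: (gcomp _ _) => [p|//=].
by rewrite /= eqxx Nk E.
Qed.

(** The equation between Boolean masks matches letters and events position by position, so lengths,
    counts and absence of interface actions transfer both ways. *)
Lemma fires_exec N m es m' g : branching N -> fires N m es m' -> labelled N m g ->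
  exists s g', [/\ gexec g s g', labelled N m' g' &
    [seq a \in Sig i | a <- s] = [seq comp_event i N k | k <- es]].
Proof.
move=> bN; elim: es m g => [|k es IHes] m g /=.
  by move=> -> lg; exists [::], g.
move=> [e [Nk [en fs]]] lg; have [g1 [st1 lg1]] := fire_step bN Nk en lg.
have [s [g' [ex lg' es']]] := IHes _ _ fs lg1.
exists (ga (egt e) :: s), g'; split=> //=; first by exists g1.
by rewrite es' /comp_event Nk -participatesE //; apply: branching_gtr Nk.
Qed.

Lemma filter_idle N (s : seq Act) es :
  [seq a \in Sig i | a <- s] = [seq comp_event i N k | k <- es] ->
  (forall y, y \in es -> ~ ievent i N y) -> [seq a <- s | a \in Sig i] = [::].
Proof.
move=> E idle; apply/eqP; rewrite -(negbK (_ == _)) -has_filter.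
have -> : has (fun a => a \in Sig i) s = has id [seq comp_event i N k | k <- es].
  by rewrite -E has_map; apply: eq_has.
by apply/hasPn => b /mapP[y yes ->]; apply/negP => /comp_eventP/idle; apply.
Qed.

Definition state_of N k g := exists m, mark_of N k m /\ labelled N m g.

Lemma state_of_unique N k g g' : branching N -> state_of N k g -> state_of N k g' -> g = g'.
Proof.
move=> bN [m [mk lg]] [m' [mk' lg']]; apply: labelled_unique lg _.
by rewrite (mark_of_unique bN mk mk').
Qed.

Lemma mark_of_labelled N k m : branching N -> mark_of N k m -> exists g, labelled N m g.
Proof.
move=> bN [es [_ [_ fs]]].
by have [s [g [_ lg _]]] := fires_exec bN fs (@labelled0 N); exists g.
Qed.

End Nets.

(** * Soundness: every trace of the folding is a projected trace of the composition *)

Section Folding.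
Variables (n : nat) (Act : finType) (Sig : 'I_n -> {set Act}).
Variables (A : 'I_n -> lts Act) (i : 'I_n).
Implicit Types (N : bp A) (m : marking n) (g : gstate A) (e : event A).
Implicit Types (ss : seq (astep A)) (C : cond n -> Prop).

(** The global state attached to an i-condition is that of the event producing it, or the initial
    state for the initial condition. *)
Definition cond_state N (c : cond n) g :=
  if c.1 is Some k then state_of N k g else g = g0 A.

Definition summary_step g a g' := exists s g1,
  [/\ gexec Sig g s g1, [seq b <- s | b \in Sig i] = [::], a \in Sig i
    & gstep Sig g1 a g'].

Lemma cond_state_unique N c g g' : branching Sig N ->
  cond_state N c g -> cond_state N c g' -> g = g'.
Proof.
move=> bN; rewrite /cond_state; case: c.1 => [k|-> -> //].
exact: state_of_unique bN.
Qed.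

(* The events of [e] outside the past of the previous i-event lead from its
   global state to St(e), and e is the only i-event among them. *)
Lemma event_summary_step N k e : branching Sig N -> onth N k = Some e ->
  participates (egt e) i -> exists g g',
  [/\ cond_state N (epre e i) g, state_of N k g' & summary_step g (ga (egt e)) g'].
Proof.
move=> bN Nk pi; have [es [m [fs en mk ines]]] := local_configuration bN Nk.
have [p ci] := participates_gcomp pi; have mi := en _ _ ci.
suff [m1 [E [g [lg cg fE idle]]]] : exists m1 E g, [/\ labelled N m1 g,
    cond_state N (epre e i) g, fires N m1 E m & forall y, y \in E -> ~ ievent i N y].
  have [s [g1 [ex lg1 es1]]] := fires_exec i bN fE lg.
  have [g' [st lg']] := fire_step bN Nk en lg1.
  exists g, g'; split=> //; first by exists (fire k e m).
  exists s, g1; split=> //; first exact: filter_idle es1 idle.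
  by rewrite -participatesE //; apply: branching_gtr Nk.
case: (fires_component i fs) => [[m_none idle]|[z [mz zes iz top]]].
  exists (m0 (n:=n)), es, (g0 A); split=> //; first exact: labelled0.
  by rewrite -mi m_none.
have [m1 [mk1 fE]] := past_mark bN fs zes.
have [g lg] := mark_of_labelled i bN mk1.
exists m1, (filter (predC (past N z)) es), g; split=> //.
  by rewrite -mi mz; exists m1.
move=> y; rewrite mem_filter => /andP[/negP npast yes] iy; apply: npast.
by apply/asboolP; apply: top.
Qed.

Lemma events_take ss k : events (take k ss) = take k (events ss).
Proof. exact: map_take. Qed.

Lemma onth_events ss k s : onth ss k = Some s -> onth (events ss) k = Some (s_ev s).
Proof. by rewrite onth_map => ->. Qed.

Lemma events_onth ss k e : onth (events ss) k = Some e ->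
  exists s, onth ss k = Some s /\ s_ev s = e.
Proof. by rewrite onth_map; case: onth => //= s [<-]; exists s. Qed.

Lemma valid_branching ss : valid_run Sig i ss -> branching Sig (events ss).
Proof.
move=> vss k e /events_onth[s [sk <-]]; rewrite -events_take.
by have [] := vss _ _ sk.
Qed.

Lemma ievent_take j N l k : ievent j (take l N) k -> ievent j N k.
Proof. by case=> e [/onth_take_some[_ Nk] pe]; exists e. Qed.

Lemma ievent_mem_take j N l k : k < l -> ievent j N k -> ievent j (take l N) k.
Proof. by move=> lt [e [Nk pe]]; exists e; split=> //; apply/onth_take_some. Qed.

Lemma step_companion ss k s : valid_run Sig i ss -> onth ss k = Some s ->
  match s_comp s with
  | Some k' => companion i (take k.+1 (events ss)) k k'
  | None => ~ exists k', companion i (take k.+1 (events ss)) k k'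
  end.
Proof.
move=> vss sk; have [_ [_]] := vss _ _ sk.
rewrite (take_onth_rcons (onth_events sk)) events_take.
by rewrite size_take size_map (onth_some_lt sk).
Qed.

(** The companion test is made in the net as it was when [k] was added; marks and labels survive in
    the larger net [N]. *)
Lemma companion_state N k k' : branching Sig N -> companion i (take k.+1 N) k k' ->
  exists m m' g, [/\ mark_of N k m, mark_of N k' m', labelled N m g & labelled N m' g].
Proof.
move=> bN [ltk [_ [_ [m [m' [mk [mk' same]]]]]]].
have [g lg] := mark_of_labelled i (branching_take bN) mk.
exists m, m', g; split.
- exact: (mark_of_take bN (ltnSn k) mk).
- exact: (mark_of_take bN (ltnW (ltk : k'.+1 < k.+1)) mk').
- exact: labelled_take lg.
- by apply: (labelled_take (l := k.+1)) => j; rewrite -same.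
Qed.

(** The identified conditions are the output i-conditions of a cut-off and of its companion, which
    carry the same global state. *)
Lemma gen_eq_cond_state ss b b' : valid_run Sig i ss -> gen_eq i ss b b' ->
  forall g, cond_state (events ss) b g <-> cond_state (events ss) b' g.
Proof.
move=> vss [k [s [k' [sk [sc [m [m' [mk [mk' [-> ->]]]]]]]]]] g.
have bN := valid_branching vss; have := step_companion vss sk; rewrite sc => cp.
have [m1 [m1' [g1 [mk1 mk1' lg1 lg1']]]] := companion_state bN cp.
have [_ [/ievent_take ik [/ievent_take ik' _]]] := cp.
rewrite (mark_of_component bN ik mk) (mark_of_component bN ik' mk') /cond_state /=.
have st1 : state_of (events ss) k g1 by exists m1.
have st1' : state_of (events ss) k' g1 by exists m1'.
by split=> st; [rewrite (state_of_unique bN st st1)|rewrite (state_of_unique bN st st1')].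
Qed.

Lemma equiv_cond_state ss b b' : valid_run Sig i ss -> equiv_c i ss b b' ->
  forall g, cond_state (events ss) b g <-> cond_state (events ss) b' g.
Proof.
move=> vss; elim=> [? ? /(gen_eq_cond_state vss)|//|x y _ IH g|x y z _ IH _ IH' g] //.
  by rewrite IH.
by rewrite IH IH'.
Qed.

Definition class_state ss C g :=
  exists b, C = cls i ss b /\ cond_state (events ss) b g.

Lemma class_state_cls ss b g : valid_run Sig i ss ->
  class_state ss (cls i ss b) g -> cond_state (events ss) b g.
Proof.
move=> vss [b' [eqC]]; have : cls i ss b b' by rewrite eqC; apply: rst_refl.
by move/(equiv_cond_state vss) ->.
Qed.

Lemma fold_step_summary ss C a C' : valid_run Sig i ss -> fold_step i ss C a C' ->
  exists g g', [/\ class_state ss C g, class_state ss C' g' & summary_step g a g'].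
Proof.
move=> vss [b [b' [[k [e [p [Nk [ci [<- [eb eb']]]]]]] [-> ->]]]].
have [g [g' [cg sg st]]] := event_summary_step (valid_branching vss) Nk (gcomp_participates ci).
exists g, g'; split=> //; first by exists b; rewrite eb.
by exists b'; rewrite eb'.
Qed.

Lemma class_state_unique ss C g g' : valid_run Sig i ss ->
  class_state ss C g -> class_state ss C g' -> g = g'.
Proof.
move=> vss [b [-> cg]] /(class_state_cls vss).
exact: cond_state_unique (valid_branching vss) cg.
Qed.

Lemma class_state0 ss : class_state ss (cls i ss (None, i)) (g0 A).
Proof. by exists (None, i). Qed.

(** Each fold step gives an execution between the states of its two classes; since a class has a
    single state, consecutive executions fit together. *)
Lemma fold_ftrace_sound ss C g s : valid_run Sig i ss -> class_state ss C g ->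
  ftrace (fold_step i ss) C s ->
  exists s0 g', gexec Sig g s0 g' /\ [seq a <- s0 | a \in Sig i] = s.
Proof.
move=> vss; elim: s C g => [|a s IHs] C g cg /=; first by exists [::], g.
move=> [C' [/(fold_step_summary vss)[g1 [g' [cg1 cg' [s1 [g2 [ex1 idle ia st]]]]]]]].
rewrite (class_state_unique vss cg cg1) => /(IHs _ _ cg')[s0 [g3 [ex fs]]].
exists (s1 ++ a :: s0), g3; split; first by apply/gexec_cat; exists g2; split=> //; exists g'.
by rewrite filter_cat /= idle ia fs.
Qed.

(** The counter never increases and drops at each [t] with [b t], so strong induction on its value
    leaves only finitely many such [t]. *)
Lemma counter_eventually_idle (c : nat -> nat) (b : pred nat) :
  (forall t, c t.+1 + b t = c t) -> exists M, forall k, M <= k -> ~~ b k.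
Proof.
move=> cS; have mono t d : c (t + d) <= c t.
  by elim: d => [|d IHd]; rewrite ?addn0 // addnS; have := cS (t + d); lia.
have [v] := ubnP (c 0); elim: v 0 => // v IHv t lt_ctv.
have [[k [letk bk]]|nb] := pselect (exists k, t <= k /\ b k).
  apply: (IHv k.+1); have := cS k; rewrite bk.
  by have := mono t (k - t); rewrite subnKC //; lia.
by exists t => k letk; apply/negP => bk; apply: nb; exists k.
Qed.

(** The infinitely many finite segments are concatenated one global step at a time, by dependent
    choice on pairs of a state and the number of interface actions performed so far. *)
Lemma summary_run_trace (gs : nat -> gstate A) (u : nat -> Act) :
  ~ divergent Sig A i -> gs 0 = g0 A ->
  (forall k, summary_step (gs k) (u k) (gs k.+1)) ->
  exists w0, trA Sig A w0 /\ proj (mem (Sig i)) w0 (Inf u).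
Proof.
move=> ndiv gs0 gsS.
pose R (x : gstate A * nat) a (y : gstate A * nat) := gstep Sig x.1 a y.1 /\
  if a \in Sig i then a = u x.2 /\ y.2 = x.2.+1 else y.2 = x.2.
(* The invariant says that the current segment can still be completed to its prescribed end
   state. *)
pose Inv (x : gstate A * nat) := summary_step x.1 (u x.2) (gs x.2.+1).
have [||f [f0 /choice[a fR]]] :=
  @dependent_choice_inv _ Inv (fun x y => exists a, R x a y) (g0 A, 0).
- by rewrite /Inv /= -gs0.
- move=> [g k] [[|b s] [g1 [/= + + iu st]]].
    move=> eg _; rewrite {}eg in st; exists (gs k.+1, k.+1); split; last exact: gsS.
    by exists (u k); split; rewrite //= iu.
  move=> [g2 [st2 ex2]]; case: ifPn => // nb idle; exists (g2, k); split.
    by exists b; split; rewrite //= (negbTE nb).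
  by exists s, g1.
have tra : trA Sig A (Inf a).
  by exists (fun k => (f k).1); rewrite f0; split=> // k; case: (fR k).
pose c t := (f t).2.
have cS t : c t.+1 = c t + (a t \in Sig i).
  by have [_] := fR t; rewrite /c; case: ifP => _; [case=> _|] => ->; rewrite ?addn1 ?addn0.
have mono t t' : t <= t' -> c t <= c t'.
  move/subnKC <-; elim: (t' - t) => [|d IHd]; first by rewrite addn0.
  by rewrite addnS cS; lia.
(* Without interface actions from [M] on, the constructed trace would witness divergence. *)
have often M : exists t, M <= t /\ a t \in Sig i.
  apply: contrapT => nt; apply: ndiv; exists a; split=> //; exists M => k leMk.
  by apply/negP => ak; apply: nt; exists k.
have next t0 : exists t, c t = c t0 /\ a t \in Sig i.
  have ex : exists d, a (t0 + d) \in Sig i.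
    by have [t [le at']] := often t0; exists (t - t0); rewrite subnKC.
  (* The first interface action at or after [t0] is taken, so the counter has not changed since
     [t0]. *)
  exists (t0 + ex_minn ex); case: ex_minnP => d ad min; split=> //.
  have : forall d', d' <= d -> c (t0 + d') = c t0.
    elim=> [|d' IH ltd]; first by rewrite addn0.
    rewrite addnS cS IH ?(ltnW ltd) //.
    by case: (boolP (a _ \in _)) => [/min|]; lia.
  exact.
have /choice[phi phiP] (m : nat) : exists t, c t = m /\ a t \in Sig i.
  elim: m => [|m [t [ct at']]]; first by have := next 0; rewrite /c f0.
  by have := next t.+1; rewrite cS ct at' addn1.
exists (Inf a); split=> //; right; exists phi; split; last split.
- move=> m; rewrite ltnNge; apply/negP => /mono.
  by have [-> _] := phiP m; have [-> _] := phiP m.+1; rewrite ltnn.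
- move=> k; split=> [ak|[m <-]]; last by case: (phiP m).
  exists (c k); have [cphi aphi] := phiP (c k).
  have [lt|lt|//] := ltngtP (phi (c k)) k; have := mono _ _ lt; rewrite cS.
    by rewrite aphi cphi; lia.
  by rewrite (ak : a k \in Sig i) cphi; lia.
- congr Inf; apply/funext => m; have [cphi aphi] := phiP m.
  by have [_] := fR (phi m); rewrite aphi => -[-> _]; rewrite -/(c _) cphi.
Qed.

Lemma fold_trace_sound ss w : ~ divergent Sig A i -> valid_run Sig i ss ->
  trS i ss w -> exists w0, trA Sig A w0 /\ proj (mem (Sig i)) w0 w.
Proof.
move=> ndiv vss; case: w => [s|u] /=.
  move/(fold_ftrace_sound vss (@class_state0 ss)) => [s0 [g' [ex fs]]].
  by exists (Fin s0); split; [apply/ftrace_gexec; exists g' | rewrite /= -fs].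
move=> [qs [qs0 qsS]].
have /choice[gs gsP] k : exists g, class_state ss (qs k) g.
  by have [g [_ [cg _ _]]] := fold_step_summary vss (qsS k); exists g.
apply: (@summary_run_trace gs) => // [|k].
  by apply: (class_state_unique vss (gsP 0)); rewrite qs0; apply: class_state0.
have [g [g' [cg cg' st]]] := fold_step_summary vss (qsS k).
by rewrite (class_state_unique vss (gsP k) cg) (class_state_unique vss (gsP k.+1) cg').
Qed.

(** * Completeness for finite traces: replaying executions in the terminated net *)

Lemma cause_not_cutoff ss k y s : valid_run Sig i ss -> k < size ss ->
  le_ev (events ss) y k -> y <> k -> onth ss y = Some s -> s_comp s = None.
Proof.
move=> vss /onth_of_lt[sk ssk] leyk neyk ssy; have bN := valid_branching vss.
have [//|[z [dzk leyz]]] := le_ev_cases leyk.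
have ltzk := dprec_lt bN dzk; have leyz' := le_ev_leq bN leyz.
(* When [k] was added, no causal predecessor was a cut-off; [y] is one, through the direct cause [z]
   of [k]. *)
have [_ [nb _]] := vss _ _ ssk; apply: (nb y); first by apply/onth_take_some; split=> //; lia.
have [e [/events_onth[s' []]]] := dzk; rewrite ssk => -[<-] <- [j [j' [pj ej]]].
by exists j, z, j'; split=> //; split=> //; rewrite events_take (le_ev_take _ bN).
Qed.

(* Following companions strictly decreases the index of the event, hence ends
   at an event that is not a cut-off. *)
Lemma noncutoff_representative ss k : valid_run Sig i ss -> ievent i (events ss) k ->
  exists k' s, [/\ ievent i (events ss) k', onth ss k' = Some s, s_comp s = None,
    equiv_c i ss (Some k, i) (Some k', i)
    & forall g, state_of (events ss) k g -> state_of (events ss) k' g].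
Proof.
move=> vss; have bN := valid_branching vss; elim/ltn_ind: k => k IHk ik.
have [e [/events_onth[s [sk _]] _]] := ik.
have := step_companion vss sk; case sc: (s_comp s) => [k'|]; last first.
  by move=> _; exists k, s; split=> //; apply: rst_refl.
move=> cp; have [ltk'k [_ [/ievent_take ik' _]]] := cp.
have [k1 [s1 [ik1 sk1 sc1 eq1 st1]]] := IHk _ ltk'k ik'.
have [m [m' [g1 [mk mk' lg lg']]]] := companion_state bN cp.
exists k1, s1; split=> // [|g [m2 [mk2 lg2]]].
  apply: rst_trans eq1; apply: rst_step; exists k, s, k'; do 2!split=> //.
  exists m, m'; split=> //; split=> //; split; apply/esym.
    exact: (mark_of_component bN ik mk).
  exact: (mark_of_component bN ik' mk').
apply: st1; exists m'; split=> //; rewrite (mark_of_unique bN mk2 mk) in lg2.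
by rewrite (labelled_unique lg2 lg).
Qed.

Definition cutoff_free ss (es : seq nat) :=
  forall k s, k \in es -> onth ss k = Some s -> s_comp s = None.

(** The candidate event takes its inputs from [m], so its causes are among the fired events and none
    is a cut-off. By termination it cannot be a possible extension, hence an event with its label
    and inputs is already present. *)
Lemma terminated_step ss es m g a g' : terminated Sig i ss ->
  fires (events ss) (m0 (n:=n)) es m -> cutoff_free ss es ->
  labelled (events ss) m g -> gstep Sig g a g' ->
  exists k e, [/\ onth (events ss) k = Some e, enabled m e, ga (egt e) = a
    & labelled (events ss) (fire k e m) g'].
Proof.
move=> [vss term] fs cf lg [t [gt [ta tg]]]; have bN := valid_branching vss.
have pre j p : gcomp t j = Some p -> clab (events ss) j (m j) = Some p.1.
  by move=> cj; rewrite lg; have := tg j; rewrite cj => -[->].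
have [k [e [Nk et ej]]] : exists k e, [/\ onth (events ss) k = Some e, egt e = t
    & forall j, participates t j -> epre e j = m j].
  apply: contrapT => nk; apply: term; exists (Ev t m); split; first split=> //.
    split; first by exists m; split; [apply/reach_fires; exists es | move=> j p /pre].
    move=> k e Nk /= et; apply: contrapT => nj; apply: nk; exists k, e; split=> // j pj.
    by apply: contrapT => ne; apply: nj; exists j.
  move=> k s sk [j [z [j' [_ [/= mj le_kz]]]]]; apply: (cf k s) => //.
  apply: (fires_closed fs) le_kz.
  by case: (fires_marked j fs) => [|[z' [+ zes _]]]; rewrite mj // => -[->].
have en : enabled m e.
  by move=> j p; rewrite et => /gcomp_participates/ej.
exists k, e; split=> //; first by rewrite et.
move=> j; rewrite /fire et /participates; have := tg j.
case cj: (gcomp t j) => [p|] /= => [[_ ->]|->]; last exact: lg.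
by rewrite eqxx Nk et cj.
Qed.

(** Only i-events can be cut-offs, so replaying actions outside the interface keeps the firing
    sequence free of cut-offs. *)
Lemma terminated_idle_exec ss es m g s g' : terminated Sig i ss ->
  fires (events ss) (m0 (n:=n)) es m -> cutoff_free ss es ->
  labelled (events ss) m g -> gexec Sig g s g' ->
  [seq a <- s | a \in Sig i] = [::] ->
  exists es' m', [/\ fires (events ss) m es' m', labelled (events ss) m' g',
    cutoff_free ss (es ++ es') & forall y, y \in es' -> ~ ievent i (events ss) y].
Proof.
move=> term; have [vss _] := term; have bN := valid_branching vss.
elim: s es m g => [|a s IHs] es m g fs cf lg /=.
  by move=> -> _; exists [::], m; rewrite cats0.
move=> [g1 [st ex]]; case: ifPn => // na idle.
have [k [e [Nk en ea lg1]]] := terminated_step term fs cf lg st.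
have nik : ~ ievent i (events ss) k.
  move=> [e' []]; rewrite Nk => -[<-].
  by rewrite (participatesE _ (branching_gtr bN Nk)) ea (negbTE na).
have cf1 : cutoff_free ss (rcons es k).
  move=> x s'; rewrite mem_rcons inE => /predU1P[-> sk|xes]; last exact: cf.
  have := step_companion vss sk; case: (s_comp s') => // k' [_ [/ievent_take]].
  by move/nik.
have [es' [m' [fs' lg' cf' idle']]] := IHs _ _ _ (fires_last fs Nk en) cf1 lg1 ex idle.
exists (k :: es'), m'; split=> //; first by exists e.
  by rewrite -cat_rcons.
by move=> y; rewrite inE => /predU1P[->//|/idle'].
Qed.

Lemma split_first (T : eqType) (P : pred T) (s : seq T) : has P s ->
  exists s1 a s2, [/\ s = s1 ++ a :: s2, filter P s1 = [::] & P a].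
Proof.
elim: s => //= a s IHs; case: (boolP (P a)) => [Pa _|nPa /= /IHs].
  by exists [::], a, s.
by move=> [s1 [b [s2 [-> f1 Pb]]]]; exists (a :: s1), b, s2; rewrite /= (negbTE nPa).
Qed.

Lemma cls_eq ss b b' : equiv_c i ss b b' -> cls i ss b = cls i ss b'.
Proof.
move=> eqb; apply/funext => c; apply/propext; split; apply: rst_trans => //.
exact: rst_sym.
Qed.

(* Induction on the number of interface letters: once the next i-event k is
   replayed, the events concurrent with it are postponed after [k], and the
   remaining execution is restarted from a non-cut-off event with state St(k). *)
Lemma fold_ftrace_complete ss es m g s : terminated Sig i ss ->
  fires (events ss) (m0 (n:=n)) es m -> cutoff_free ss es ->
  labelled (events ss) m g ->
  (forall y, y \in es -> exists z, m i = (Some z, i) /\ le_ev (events ss) y z) ->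
  ftrace (@gstep _ _ Sig A) g s ->
  ftrace (fold_step i ss) (cls i ss (m i)) [seq a <- s | a \in Sig i].
Proof.
move=> term; have [vss _] := term; have bN := valid_branching vss.
have [c] := ubnP (count (fun a => a \in Sig i) s).
elim: c es m g s => // c IHc es m g s lt_sc fs cf lg top tr.
have [|nos] := boolP (has (fun a => a \in Sig i) s); last first.
  by move: nos; rewrite has_filter negbK => /eqP->.
move=> /split_first[s1 [a [s2 [es12 idle1 ia]]]].
move: tr lt_sc; rewrite {s}es12 count_cat filter_cat /= idle1 ia /=.
move=> /ftrace_gexec[g' /gexec_cat[g1 [ex1 /= [g2 [st2 ex2]]]]] lt_sc.
have [es1 [m1 [fs1 lg1 cf1 idle_es1]]] := terminated_idle_exec term fs cf lg ex1 idle1.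
have fs01 : fires (events ss) (m0 (n:=n)) (es ++ es1) m1 by apply/fires_cat; exists m.
have [k [e [Nk en ea lg2]]] := terminated_step term fs01 cf1 lg1 st2.
have pi : participates (egt e) i by rewrite (participatesE _ (branching_gtr bN Nk)) ea.
have ik : ievent i (events ss) k by exists e.
have [p ci] := participates_gcomp pi.
have ei : epre e i = m i by rewrite -(en _ _ ci) (fires_idle fs1).
have fs2 := fires_last fs01 Nk en.
have kes : k \in rcons (es ++ es1) k by rewrite mem_rcons mem_head.
have [mk [mkP fsE]] := past_mark bN fs2 kes.
have [gk lgk] := mark_of_labelled i bN mkP.
have [sE [g2' [exE lg2' mapE]]] := fires_exec i bN fsE lgk.
rewrite {g2' lg2'}(labelled_unique lg2' lg2) in exE.
(* No i-event is postponed: by [top], every event of [es] lies below the producer of [m i], which is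
   a direct cause of [k], and [es1] has no i-events. *)
have idleE : [seq b <- sE | b \in Sig i] = [::].
  apply: filter_idle mapE _ => y; rewrite mem_filter mem_rcons inE mem_cat.
  move=> /andP[/= npast /or3P[/eqP ey|yes|/idle_es1 //]] _; case/negP: npast; apply/asboolP.
    by rewrite ey; apply: rt_refl.
  have [z [mz le_yz]] := top y yes; apply: rt_trans le_yz (rt_step _ _ _ _ _).
  by exists e; split=> //; exists i, i; rewrite ei.
have [k1 [s' [ik1 sk1 sc1 eq1 st1]]] := noncutoff_representative vss ik.
exists (cls i ss (Some k, i)); split.
  by exists (m i), (Some k, i); split=> //; exists k, e, p; rewrite ei.
have [e1 [Nk1 pi1]] := ik1.
have [esk [mk1 [fsk1 enk1 mk1P inesk]]] := local_configuration bN Nk1.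
have [|mk2 [mk2P lgk2]] := st1 gk; first by exists mk.
rewrite (mark_of_unique bN mk2P mk1P) in lgk2.
have mk1i : fire k1 e1 mk1 i = (Some k1, i) by apply: fire_participates.
have le_k1 y : y \in rcons esk k1 -> le_ev (events ss) y k1.
  by rewrite mem_rcons inE => /predU1P[->|/inesk[]//]; apply: rt_refl.
rewrite (cls_eq eq1) -mk1i.
(* The labels [sE] of the postponed events are prepended: they are invisible, and they lead from the
   state of [k], shared by [k1], to the state where [s2] starts. *)
have -> : [seq b <- s2 | b \in Sig i] = [seq b <- sE ++ s2 | b \in Sig i].
  by rewrite filter_cat idleE.
apply: (IHc (rcons esk k1) _ gk) => //.
- rewrite count_cat -[count _ sE]size_filter idleE /=.
  by move: lt_sc; rewrite -[count _ s1]size_filter idle1 /=; lia.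
- exact: fires_last.
- move=> y sy yes ssy; have [eyk|neyk] := eqVneq y k1.
    by move: ssy; rewrite eyk sk1 => -[<-].
  apply: (cause_not_cutoff vss (onth_some_lt sk1) (le_k1 _ yes)) ssy; exact/eqP.
- by move=> y /le_k1 le; exists k1.
- by apply/ftrace_gexec; exists g'; apply/gexec_cat; exists g2.
Qed.

Lemma fold_ftrace_complete0 ss s : terminated Sig i ss ->
  ftrace (@gstep _ _ Sig A) (g0 A) s ->
  ftrace (fold_step i ss) (cls i ss (None, i)) [seq a <- s | a \in Sig i].
Proof.
move=> term tr; apply: (@fold_ftrace_complete _ [::] (m0 (n:=n)) (g0 A)) => //.
exact: labelled0.
Qed.

(** * Completeness for infinite traces *)

Lemma mkseqSl T (f : nat -> T) k : mkseq f k.+1 = f 0 :: mkseq (fun x => f x.+1) k.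
Proof. by rewrite /mkseq /= (iotaDl 1 0) -map_comp. Qed.

Lemma ftrace_catl Q X (step : Q -> X -> Q -> Prop) q s s' :
  ftrace step q (s ++ s') -> ftrace step q s.
Proof. by elim: s q => //= a s IHs q [q' [st /IHs tr]]; exists q'. Qed.

Lemma mkseq_ftrace_le Q X (step : Q -> X -> Q -> Prop) q (u : nat -> X) k k' :
  k <= k' -> ftrace step q (mkseq u k') -> ftrace step q (mkseq u k).
Proof.
move=> /subnKC <-; rewrite /mkseq iotaD map_cat; exact: ftrace_catl.
Qed.

(** Koenig's lemma on the runs of the folding: the invariant keeps a class from which all finite
    prefixes of the remaining word can be read. *)
Lemma fold_trace_compact ss C (u : nat -> Act) :
  (forall k, ftrace (fold_step i ss) C (mkseq u k)) ->
  is_trace C (fold_step i ss) (Inf u).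
Proof.
move=> tr.
pose Inv (x : (cond n -> Prop) * nat) := forall k,
  ftrace (fold_step i ss) x.1 (mkseq (fun t => u (x.2 + t)) k).
pose R (x y : (cond n -> Prop) * nat) := fold_step i ss x.1 (u x.2) y.1 /\ y.2 = x.2.+1.
have [//|[D t] /= ID|f [f0 fS]] := @dependent_choice_inv _ Inv R (C, 0).
  (* Every target class is the class of the output i-condition of one of the [size ss] events, so
     the branching is finite. *)
  pose c (k : 'I_(size ss)) : cond n -> Prop := cls i ss (Some (val k), i).
  have [||k kP] := @finite_compactness _ (fun k l => fold_step i ss D (u t) (c k) /\
      ftrace (fold_step i ss) (c k) (mkseq (fun x => u (t.+1 + x)) l)).
  - by move=> k l l' le [st tr']; split=> //; apply: mkseq_ftrace_le le tr'.
  - move=> l; have := ID l.+1; rewrite mkseqSl /= addn0 => -[D' [st trl]].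
    have [b [b' [[k [e [p [Nk [_ [_ [_ eb]]]]]]] [_ eD']]]] := st.
    have ltk : k < size ss by rewrite -(size_map (@s_ev _ _ A)); apply: onth_some_lt Nk.
    exists (Ordinal ltk); rewrite /c /= -eb -eD'; split=> //.
    by congr (ftrace _ _ _): trl; apply: eq_mkseq => x; rewrite addSnnS.
  by exists (c k, t.+1); split; [split=> //; case: (kP 0) | move=> l; case: (kP l)].
exists (fun k => (f k).1); rewrite f0; split=> // k.
have f2 : (f k).2 = k by elim: k => [|k IHk]; [rewrite f0 | case: (fS k) => _ ->; rewrite IHk].
by have [+ _] := fS k; rewrite f2.
Qed.

Lemma increasing_leq (phi : nat -> nat) : (forall k, phi k < phi k.+1) ->
  {mono phi : x y / x <= y}.
Proof.
move=> inc; apply: leq_mono => x y; elim: y => // y IHy.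
rewrite ltnS leq_eqVlt => /predU1P[-> //|/IHy lt]; exact: ltn_trans lt (inc y).
Qed.

(** Both lists are strictly increasing and have the same elements. *)
Lemma filter_iota_image (P : pred nat) (phi : nat -> nat) k :
  (forall x, phi x < phi x.+1) -> (forall x, P x <-> exists y, phi y = x) ->
  [seq x <- iota 0 (phi k) | P x] = mkseq phi k.
Proof.
move=> inc im; have mono := increasing_leq inc.
have smono : {mono phi : x y / x < y} by apply: leqW_mono.
apply: (irr_sorted_eq ltn_trans ltnn).
- by apply: sorted_filter; [apply: ltn_trans | apply: iota_ltn_sorted].
- rewrite /mkseq sorted_map.
  by rewrite (eq_sorted (e' := ltn)) ?iota_ltn_sorted // => x y /=; rewrite smono.
move=> x; rewrite mem_filter mem_iota /= add0n; apply/andP/mapP.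
  move=> [/im[y <-]]; rewrite smono => lt; exists y => //.
  by rewrite mem_iota.
move=> [y]; rewrite mem_iota /= add0n => lt ->; split; last by rewrite smono.
by apply/im; exists y.
Qed.

Lemma trA_prefix (u : nat -> Act) k : trA Sig A (Inf u) ->
  ftrace (@gstep _ _ Sig A) (g0 A) (mkseq u k).
Proof.
move=> [qs [<- qsS]]; elim: k u qs qsS => // k IHk u qs qsS.
rewrite mkseqSl; exists (qs 1); split=> //.
exact: (IHk (fun x => u x.+1) (fun x => qs x.+1)).
Qed.

Lemma fold_trace_complete ss w0 w : ~ divergent Sig A i -> terminated Sig i ss ->
  trA Sig A w0 -> proj (mem (Sig i)) w0 w -> trS i ss w.
Proof.
move=> ndiv term; case: w0 => [s|u] tr0 /=.
  by move=> ->; apply: fold_ftrace_complete0.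
(* An infinite trace with a finite projection would make the composition divergent. *)
case=> [[M [idle _]]|[phi [inc [im ->]]]].
  by case: ndiv; exists u; split=> //; exists M.
apply: fold_trace_compact => k.
have := fold_ftrace_complete0 term (trA_prefix (phi k) tr0).
rewrite /mkseq filter_map (eq_filter (a2 := fun x => u x \in Sig i)) //.
by rewrite (filter_iota_image (phi := phi)) // -map_comp.
Qed.

End Folding.

(** * Termination: bounding the size of the past of every event *)

Section Termination.
Variables (n : nat) (Act : finType) (Sig : 'I_n -> {set Act}).
Variables (A : 'I_n -> lts Act) (i : 'I_n).
Implicit Types (N : bp A) (m : marking n) (g : gstate A) (e : event A).
Implicit Types (ss : seq (astep A)).

(** This finite counterpart of the function type [gstate] makes global states available to
    pigeonhole and counting arguments. *)
Let fstate : finType := {dffun forall j : 'I_n, st (A j)}.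

Let fstate_gstate (d : fstate) : gstate A := fun j => d j.

Lemma fstate_surj g : exists d : fstate, fstate_gstate d = g.
Proof.
exists (finfun g); apply: functional_extensionality_dep => j.
by rewrite /fstate_gstate ffunE.
Qed.

(** Koenig's lemma again: if executions with at most [c] interface actions were unboundedly long,
    some successor would always keep this property with the remaining budget. The budget drops at
    each interface action, so the resulting infinite trace would be divergent. *)
Lemma nondivergent_bound c : ~ divergent Sig A i -> exists B, forall s g',
  gexec Sig (g0 A) s g' -> count (fun a => a \in Sig i) s <= c -> size s < B.
Proof.
move=> ndiv; apply: contrapT => nB; apply: ndiv.
pose Inv (x : gstate A * nat) := forall B, exists s g',
  [/\ gexec Sig x.1 s g', count (fun a => a \in Sig i) s <= x.2 & B <= size s].
pose R (x : gstate A * nat) a (y : gstate A * nat) :=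
  gstep Sig x.1 a y.1 /\ y.2 + (a \in Sig i) = x.2.
have [||f [f0 /choice[a fR]]] :=
  @dependent_choice_inv _ Inv (fun x y => exists a, R x a y) (g0 A, c).
- move=> B; apply: contrapT => ns; apply: nB; exists B => s g' ex le.
  by rewrite ltnNge; apply/negP => leB; apply: ns; exists s, g'.
- move=> [g v] /= Ig.
  have [||[a d] adP] := @finite_compactness (Act * fstate)%type (fun x B => exists s g',
    [/\ gstep Sig g x.1 (fstate_gstate x.2), gexec Sig (fstate_gstate x.2) s g',
        count (fun b => b \in Sig i) s + (x.1 \in Sig i) <= v & B <= size s]).
  + move=> [a d] B B' le [s [g' [st ex lec leB]]]; exists s, g'; split=> //.
    exact: leq_trans le leB.
  + move=> B; have [[|a s] [g' [//= [g1 [st ex]] lec leB]]] := Ig B.+1.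
    have [d ed] := fstate_surj g1; exists (a, d), s, g'; rewrite ed; split=> //.
    by rewrite addnC.
  exists (fstate_gstate d, v - (a \in Sig i)); split.
    by have [s [g' [st _ le _]]] := adP 0; exists a; split=> //=; move: le => /=; lia.
  move=> B; have [s [g' [_ ex le leB]]] := adP B; exists s, g'; split=> //=.
  by move: le => /=; lia.
exists a; split; last first.
  by apply: (@counter_eventually_idle (fun t => (f t).2)) => t; case: (fR t).
by exists (fun k => (f k).1); rewrite f0; split=> // k; case: (fR k).
Qed.

(** An earlier i-event with the same global state would have been a companion of [k] when [k] was
    added. *)
Lemma noncutoff_state_leq ss k k' s g : valid_run Sig i ss -> onth ss k = Some s ->
  s_comp s = None -> ievent i (events ss) k -> ievent i (events ss) k' ->
  state_of (events ss) k g -> state_of (events ss) k' g -> k <= k'.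
Proof.
move=> vss sk sc ik ik' st st'; rewrite leqNgt; apply/negP => ltk.
have bN := valid_branching vss; have := step_companion vss sk; rewrite sc; apply.
have bT := branching_take (k := k.+1) bN.
(* The companion test concerns the prefix ending with [k], so the marks are rebuilt there;
   uniqueness of the state identifies their labels. *)
have mark y : y < k.+1 -> ievent i (events ss) y -> state_of (events ss) y g ->
    exists m, mark_of (take k.+1 (events ss)) y m /\ labelled (take k.+1 (events ss)) m g.
  move=> lty /(ievent_mem_take lty)[e [Ny _]] sty.
  have [_ [m1 [_ _ mk _]]] := local_configuration bT Ny.
  have [g1 lg1] := mark_of_labelled i bT mk; exists (fire y e m1); split=> //.
  have sty1 : state_of (events ss) y g1.
    by exists (fire y e m1); split; [apply: (mark_of_take bN) mk | apply: labelled_take lg1].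
  by rewrite (state_of_unique bN sty sty1).
have [m [mk lg]] := mark k (ltnSn k) ik st.
have [m' [mk' lg']] := mark k' (ltnW (ltk : k'.+1 < k.+1)) ik' st'.
exists k'; split=> //; split; first exact: ievent_mem_take.
split; first by apply: ievent_mem_take ik'; apply: ltnW.
by exists m, m'; do 2!split=> //; move=> j; rewrite lg lg'.
Qed.

(* Distinct i-events of [k] other than k have distinct global states, so their
   number is bounded, and non-divergence bounds the number of events between. *)
Lemma past_bound : ~ divergent Sig A i -> exists B, forall ss k, valid_run Sig i ss ->
  k < size ss -> exists es : seq nat,
  [/\ uniq es, forall y, y \in es <-> le_ev (events ss) y k & size es <= B].
Proof.
move=> /(nondivergent_bound #|fstate|)[B BP]; exists B => ss k vss ltk.
have bN := valid_branching vss.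
have [e Nk] : exists e, onth (events ss) k = Some e by apply: onth_of_lt; rewrite size_map.
have [es [m [fs en mk ines]]] := local_configuration bN Nk.
have uq := fires_uniq bN fs.
exists (k :: es); split=> [|y|].
- by rewrite /= uq andbT; apply/negP => /ines[].
- rewrite inE; split=> [/predU1P[->|/ines[] //]|le]; first exact: rt_refl.
  by have [//|/eqP ne] := eqVneq y k; apply/ines.
have [s [g' [ex _ mapE]]] := fires_exec i bN fs (@labelled0 _ _ A (events ss)).
have sz : size s = size es by rewrite -(size_map (fun a => a \in Sig i)) mapE size_map.
rewrite /= -sz; apply: BP ex _.
have -> : count (fun a => a \in Sig i) s = size (filter (comp_event i (events ss)) es).
  by rewrite size_filter -[LHS](count_map _ id) mapE count_map.
have stP y : exists d : fstate, ievent i (events ss) y ->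
    state_of (events ss) y (fstate_gstate d).
  have [iy|niy] := pselect (ievent i (events ss) y); last first.
    by have [d _] := fstate_surj (g0 A); exists d.
  have [ey [Ny _]] := iy; have [_ [m1 [_ _ mky _]]] := local_configuration bN Ny.
  have [g lg] := mark_of_labelled i bN mky; have [d ed] := fstate_surj g.
  by exists d => _; exists (fire y ey m1); rewrite ed.
have {stP} [h hP] := choice stP.
have : uniq (map h (filter (comp_event i (events ss)) es)).
  rewrite map_inj_in_uniq ?filter_uniq // => x y.
  (* An i-event strictly below [k] is not a cut-off, so two of them with the same state bound each
     other's index and coincide. *)
  have main x' y' : x' \in filter (comp_event i (events ss)) es ->
      y' \in filter (comp_event i (events ss)) es -> h x' = h y' -> x' <= y'.
    rewrite !mem_filter => /andP[/comp_eventP ix /ines[lex nex]] /andP[/comp_eventP iy _] eh.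
    have [ex' [/events_onth[sx [ssx _]] _]] := ix.
    apply: (noncutoff_state_leq vss ssx _ ix iy (hP _ ix)); last by rewrite eh; apply: hP.
    exact: (cause_not_cutoff vss ltk lex nex ssx).
  by move=> xes yes eh; apply/eqP; rewrite eqn_leq !main.
by move/card_uniqP; rewrite size_map => <-; apply: max_card.
Qed.

(** * An infinite run contains only finitely many events of each causal depth *)

Section InfiniteRun.
Variable f : nat -> astep A.
Hypothesis validf : forall k, valid_run Sig i (mkseq f k).

Let net k : bp A := events (mkseq f k).

Let branching_net k : branching Sig (net k).
Proof. exact: (valid_branching (@validf k)). Qed.

Let onth_net k l : k < l -> onth (net l) k = Some (s_ev (f k)).
Proof.
move=> lt; rewrite /net /events onth_map onthE (nth_map (f 0)) ?size_mkseq //=.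
by rewrite nth_mkseq.
Qed.

Let take_net k l : k <= l -> take k (net l) = net k.
Proof.
move=> lekl; rewrite /net -events_take /mkseq -map_take take_iota.
by rewrite (minn_idPl lekl).
Qed.

Definition run_cause k' k :=
  exists j j', participates (egt (s_ev (f k))) j /\ epre (s_ev (f k)) j = (Some k', j').

Let dprec_net k' k l : k < l -> dprec (net l) k' k <-> run_cause k' k.
Proof.
move=> lt; split=> [[e []]|c]; first by rewrite onth_net // => -[<-].
by exists (s_ev (f k)); rewrite onth_net.
Qed.

(** Every chain of direct causes ending in [k] has at most [d] events, [k] included. *)
Fixpoint depth_lt d k : Prop :=
  if d is d'.+1 then forall k', run_cause k' k -> depth_lt d' k' else False.

(** A list covering the past of [k] covers the past of each direct cause even after [k] is removed
    from it. *)
Lemma past_size_depth d k (es : seq nat) :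
  (forall y, le_ev (net k.+1) y k -> y \in es) -> size es <= d -> depth_lt d k.
Proof.
elim: d k es => [|d IHd] k es ines.
  by rewrite leqn0 size_eq0 => /eqP es0; have := ines k (rt_refl _ _ _); rewrite es0.
move=> le_es k' cause; have dk : dprec (net k.+1) k' k by apply/dprec_net.
have ltk := dprec_lt (@branching_net k.+1) dk.
apply: (IHd k' (rem k es)) => [y leyk'|].
  have leyk : le_ev (net k.+1) y k'.
    by rewrite -(take_net (ltnW (ltk : k'.+1 < k.+1))) in leyk';
       apply/(le_ev_take _ (@branching_net _) (ltnSn k')).
  have nek : y != k.
    by have := le_ev_leq (@branching_net _) leyk; apply: contraTneq => ->; rewrite -ltnNge.
  have: y \in es by apply: ines; apply: rt_trans leyk (rt_step _ _ _ _ dk).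
  have : k \in es by apply: ines; apply: rt_refl.
  by move/perm_to_rem/perm_mem->; rewrite inE (negbTE nek).
have kes : k \in es by apply: ines; apply: rt_refl.
by rewrite size_rem // -subn1 leq_subLR add1n.
Qed.

Let net_epre k j : participates (egt (s_ev (f k))) j ->
  epre (s_ev (f k)) j = (None, j) \/
  exists z, epre (s_ev (f k)) j = (Some z, j) /\ run_cause z k.
Proof.
move=> pj; have Nk := onth_net (ltnSn k).
case: (branching_epre (@branching_net _) Nk pj) => [|[z [ez _ _ dz]]]; first by left.
by right; exists z; split=> //; apply/(dprec_net _ (ltnSn k)).
Qed.

(* An event is determined by its label and its input conditions, so only
   finitely many events can be built on finitely many conditions. *)
Lemma depth_bound d : exists L, forall k, depth_lt d k -> k < L.
Proof.
elim: d => [|d [L LP]]; first by exists 0.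
(* The key ranges over a finite type. Outer [None] stands for an initial condition; at depth below
   [d.+1], the producer of any other input has index below [L] by induction, so [insub] loses
   nothing. *)
pose key k : (Act * {dffun forall j : 'I_n, option (st (A j) * st (A j))})
             * {ffun 'I_n -> option (option 'I_L)} :=
  let e := s_ev (f k) in
  (ga (egt e), finfun (gcomp (egt e)),
   [ffun j => omap (fun z => insub z) (epre e j).1]).
have key_ge k k' : depth_lt d.+1 k -> depth_lt d.+1 k' -> key k = key k' -> k' <= k.
  move=> dk dk' [ega ecomp epre_eq]; rewrite leqNgt; apply/negP => lt.
  have egt_eq : egt (s_ev (f k)) = egt (s_ev (f k')).
    move: ega ecomp; case: (egt (s_ev (f k))) => a1 c1; case: (egt (s_ev (f k'))) => a2 c2 /=.
    move=> -> ec; congr GTr; apply: functional_extensionality_dep => j.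
    by have := congr1 (fun h : {dffun forall j : 'I_n, _} => h j) ec; rewrite !ffunE.
  have [_ [_]] := branching_net (onth_net (ltnSn k')).
  move=> /(_ k (s_ev (f k)))[||j [pj]] //.
    by apply/onth_take_some; rewrite onth_net //; apply: ltnW.
  apply; have pj0 : participates (egt (s_ev (f k))) j by rewrite egt_eq.
  have := congr1 (fun h : {ffun _} => h j) epre_eq; rewrite !ffunE.
  case: (net_epre pj) => [->|[z [-> /dk'/LP ltz]]];
  case: (net_epre pj0) => [->|[z' [-> /dk/LP ltz']]] //=.
  by rewrite !insubT => -[->].
have [t|t L1 L2 le LP1 k dk kt|L' L'P] := @finite_bound _
  (fun t L' => forall k, depth_lt d.+1 k -> key k = t -> k < L').
(* By [key_ge], any one event with key [t] bounds the index of all others with that key. *)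
- have [[k [dk kt]]|nk] := pselect (exists k, depth_lt d.+1 k /\ key k = t).
    by exists k.+1 => k' dk' kt'; rewrite ltnS; apply: key_ge; rewrite ?kt.
  by exists 0 => k dk kt; case: nk; exists k.
- exact: leq_trans (LP1 k dk kt) le.
- by exists L' => k dk; apply: L'P dk _.
Qed.

End InfiniteRun.

(** The bound [B] on pasts bounds the depth of all events, so all indices would be below [L],
    although the run contains an event of index [L]. *)
Lemma no_infinite_run : ~ divergent Sig A i ->
  ~ exists f : nat -> astep A, forall k, valid_run Sig i (mkseq f k).
Proof.
move=> /past_bound[B BP] [f validf].
have [L LP] := depth_bound validf B; suff /LP : depth_lt f B L by rewrite ltnn.
have ltL : L < size (mkseq f L.+1) by rewrite size_mkseq.
have [es [_ ines le_es]] := BP _ _ (validf L.+1) ltL.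
by apply: (past_size_depth validf) le_es => y /ines.
Qed.

End Termination.

Theorem theorem1 (n : nat) (Act : finType) (Sig : 'I_n -> {set Act})
    (A : 'I_n -> lts Act) (i : 'I_n)
    (Hlab : forall j p, p \in tr (A j) -> lab (A j) p \in Sig j)
    (Hnd : ~ divergent Sig A i) :
  (~ exists f : nat -> astep A,
       forall m, valid_run Sig i (mkseq f m)) /\
  (forall ss : seq (astep A), terminated Sig i ss ->
     forall w : word Act,
       trS i ss w <-> exists w0, trA Sig A w0 /\ proj (mem (Sig i)) w0 w).
Proof.
split=> [|ss term w]; first exact: no_infinite_run.
split=> [|[w0 [tr0 pr]]]; first by apply: fold_trace_sound => //; case: term.
exact: fold_trace_complete tr0 pr.
Qed.
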